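(* For all finite types $\sigma,\tau$, let $\phi:=(\sigma\to0)\to(\tau\to0)$ and $\rho:=\phi\to(\sigma\to0)\to(\sigma\to0)\to\tau\to\sigma$. Then $\mathsf{HA}^\omega$ proves $$\exists Z:\rho^+\;\forall f:\phi^+\Big(\mathrm{dom}_\phi(f)\to\forall x:(\sigma\to0)^+\big(\mathrm{dom}_{\sigma\to0}(x)\to\forall y:(\sigma\to0)^+\big(\mathrm{dom}_{\sigma\to0}(y)\to\forall v:\tau^+\big(\mathrm{dom}_\tau(v)\to(\neg(f*x*v\equiv_0f*y*v)\to\mathrm{dom}_\sigma(Z*f*x*y*v)\wedge\neg(x*(Z*f*x*y*v)\equiv_0y*(Z*f*x*y*v)))\big)\big)\big)\Big).$$
   Context: Finite types are generated by: $0$ is a type; if $\sigma,\tau$ are types, so are $\sigma\times\tau$ and $\sigma\to\tau$ ($\to$ associates to the right). $\mathsf{HA}^\omega$ is the many-sorted intuitionistic first-order theory whose sorts are the finite types. Its terms are built from variables of each type and, for all types $\rho,\sigma,\tau$, the constants $\mathsf{k}:\rho\to\sigma\to\rho$, $\mathsf{s}:(\rho\to\sigma\to\tau)\to(\rho\to\sigma)\to(\rho\to\tau)$, $\mathsf{pair}:\sigma\to\tau\to\sigma\times\tau$, $\mathsf{fst}:\sigma\times\tau\to\sigma$, $\mathsf{snd}:\sigma\times\tau\to\tau$, $0:0$, $S:0\to0$, $\mathsf{R}:\sigma\to(0\to\sigma\to\sigma)\to0\to\sigma$, by application (associating to the left). Atomic formulas are $\bot$ and $s\equiv_\sigma t$;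 $\neg\varphi$ abbreviates $\varphi\to\bot$. Axioms: $\equiv_\sigma$ is an equivalence relation; $x\equiv x'\to y\equiv y'\to xy\equiv x'y'$; $\mathsf{k}xy\equiv x$; $\mathsf{s}xyz\equiv xz(yz)$; $\mathsf{fst}(\mathsf{pair}\,xy)\equiv x$; $\mathsf{snd}(\mathsf{pair}\,xy)\equiv y$; $\mathsf{R}xy0\equiv x$; $\mathsf{R}xy(Sm)\equiv ym(\mathsf{R}xym)$; $Sx\equiv_0Sy\to x\equiv_0y$; $\neg(Sx\equiv_00)$; induction for all formulas. Surjective pairing is not assumed. Auxiliary types and $\mathsf{HA}^\omega$-formulas (by induction on $\sigma$): $0^+:=0$, $0^-:=0$, $\mathrm{dom}_0(x):=\top$, $\mathrm{app}_0(x,y,z):=\neg(x\equiv_0y)$. $(\sigma\times\tau)^+:=\sigma^+\times\tau^+$, $(\sigma\times\tau)^-:=(\sigma^-\times\tau^-)\times0$, $\mathrm{dom}_{\sigma\times\tau}(x):=\mathrm{dom}_\sigma(\mathsf{fst}\,x)\wedge\mathrm{dom}_\tau(\mathsf{snd}\,x)$, $\mathrm{app}_{\sigma\times\tau}(x,y,z):=(\mathsf{snd}\,z\equiv_00\to\mathrm{app}_\sigma(\mathsf{fst}\,x,\mathsf{fst}\,y,\mathsf{fst}(\mathsf{fst}\,z)))\wedge(\neg(\mathsf{snd}\,z\equiv_00)\to\mathrm{app}_\tau(\mathsf{snd}\,x,\mathsf{snd}\,y,\mathsf{snd}(\mathsf{fst}\,z)))$. $(\sigma\to\tau)^+:=(\sigma^+\to\tau^+)\times(\sigma^+\to\sigma^+\to\tau^-\to\sigma^-)$,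 $(\sigma\to\tau)^-:=\sigma^+\times\tau^-$; for $s:(\sigma\to\tau)^+$, $t:\sigma^+$ write $s*t:=(\mathsf{fst}\,s)t:\tau^+$ ($*$ associates to the left); $\mathrm{dom}_{\sigma\to\tau}(x):=\forall u:\sigma^+(\mathrm{dom}_\sigma(u)\to\mathrm{dom}_\tau(x*u))\wedge\forall u,v:\sigma^+\forall w:\tau^-(\mathrm{dom}_\sigma(u)\to\mathrm{dom}_\sigma(v)\to\mathrm{app}_\tau(x*u,x*v,w)\to\mathrm{app}_\sigma(u,v,(\mathsf{snd}\,x)uvw))$; $\mathrm{app}_{\sigma\to\tau}(x,y,z):=\mathrm{dom}_\sigma(\mathsf{fst}\,z)\wedge\mathrm{app}_\tau(x*(\mathsf{fst}\,z),y*(\mathsf{fst}\,z),\mathsf{snd}\,z)$. *)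

(* Defs.v *)
From Stdlib Require Import List.
Import ListNotations.

Set Implicit Arguments.
Unset Strict Implicit.
Unset Printing Implicit Defensive.

Inductive ty : Type :=
| Nat : ty
| Prod : ty -> ty -> ty
| Arr : ty -> ty -> ty.

Declare Scope ty_scope.
Delimit Scope ty_scope with ty.
Bind Scope ty_scope with ty.
Notation "σ ⊗ τ" := (Prod σ τ) (at level 40, left associativity) : ty_scope.
Notation "σ ⟶ τ" := (Arr σ τ) (at level 55, right associativity) : ty_scope.
Local Open Scope ty_scope.

(** Variables are typed de Bruijn indices: a term of type [tm G σ] has type [σ]
    and its free variables are among the positions of the context [G], the most
    recently bound variable being the head of [G]. *)

Definition ctx : Type := list ty.

Inductive var : ctx -> ty -> Type :=
| vz (G : ctx) (σ : ty) : var (σ :: G) σ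
| vs (G : ctx) (σ τ : ty) : var G σ -> var (τ :: G) σ.

Arguments vz {G σ}.
Arguments vs {G σ τ} _.

Inductive tm (G : ctx) : ty -> Type :=
| Var (σ : ty) : var G σ -> tm G σ
| App (σ τ : ty) : tm G (σ ⟶ τ) -> tm G σ -> tm G τ
| cK (ρ σ : ty) : tm G (ρ ⟶ σ ⟶ ρ)
| cS (ρ σ τ : ty) : tm G ((ρ ⟶ σ ⟶ τ) ⟶ (ρ ⟶ σ) ⟶ ρ ⟶ τ)
| cPair (σ τ : ty) : tm G (σ ⟶ τ ⟶ σ ⊗ τ)
| cFst (σ τ : ty) : tm G (σ ⊗ τ ⟶ σ)
| cSnd (σ τ : ty) : tm G (σ ⊗ τ ⟶ τ)
| cZero : tm G Nat
| cSucc : tm G (Nat ⟶ Nat)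
| cRec (σ : ty) : tm G (σ ⟶ (Nat ⟶ σ ⟶ σ) ⟶ Nat ⟶ σ).

Arguments Var {G σ} _.
Arguments App {G σ τ} _ _.
Arguments cK {G} ρ σ.
Arguments cS {G} ρ σ τ.
Arguments cPair {G} σ τ.
Arguments cFst {G} σ τ.
Arguments cSnd {G} σ τ.
Arguments cZero {G}.
Arguments cSucc {G}.
Arguments cRec {G} σ.

Declare Scope tm_scope.
Delimit Scope tm_scope with tm.
Bind Scope tm_scope with tm.
Notation "s · t" := (App s t) (at level 38, left associativity) : tm_scope.
Local Open Scope tm_scope.

Definition pair_ {G σ τ} (s : tm G σ) (t : tm G τ) : tm G (σ ⊗ τ) :=
  cPair σ τ · s · t.
Definition fst_ {G σ τ} (s : tm G (σ ⊗ τ)) : tm G σ := cFst σ τ · s.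
Definition snd_ {G σ τ} (s : tm G (σ ⊗ τ)) : tm G τ := cSnd σ τ · s.

Notation v0 := (Var vz).
Notation v1 := (Var (vs vz)).
Notation v2 := (Var (vs (vs vz))).
Notation v3 := (Var (vs (vs (vs vz)))).
Notation v4 := (Var (vs (vs (vs (vs vz))))).

Inductive fm : ctx -> Type :=
| Bot (G : ctx) : fm G
| Eq (G : ctx) (σ : ty) : tm G σ -> tm G σ -> fm G
| And (G : ctx) : fm G -> fm G -> fm G
| Or (G : ctx) : fm G -> fm G -> fm G
| Imp (G : ctx) : fm G -> fm G -> fm G
| All (G : ctx) (σ : ty) : fm (σ :: G) -> fm G
| Ex (G : ctx) (σ : ty) : fm (σ :: G) -> fm G.

Arguments Bot {G}.
Arguments Eq {G σ} _ _.
Arguments All {G} σ _.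
Arguments Ex {G} σ _.

Declare Scope fm_scope.
Delimit Scope fm_scope with fm.
Bind Scope fm_scope with fm.
Notation "s ≡ t" := (Eq s%tm t%tm) (at level 70, no associativity) : fm_scope.
Notation "A ⊃ B" := (Imp A B) (at level 85, right associativity) : fm_scope.
Notation "A ∧ B" := (And A B) (at level 80, right associativity) : fm_scope.
Notation "A ∨ B" := (Or A B) (at level 82, right associativity) : fm_scope.
Notation "¬ A" := (Imp A Bot) (at level 75, right associativity) : fm_scope.
Notation "∀[ σ ] A" := (All σ%ty A) (at level 90, right associativity) : fm_scope.
Notation "∃[ σ ] A" := (Ex σ%ty A) (at level 90, right associativity) : fm_scope.
Local Open Scope fm_scope.

Definition Top {G : ctx} : fm G := Bot ⊃ Bot.

Definition scons {P : ty -> Type} {G : ctx} {τ : ty} (t : P τ)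
    (θ : forall σ, var G σ -> P σ) : forall σ, var (τ :: G) σ -> P σ :=
  fun σ x =>
    match x in var (τ' :: G') σ'
      return P τ' -> (forall σ, var G' σ -> P σ) -> P σ' with
    | vz => fun t _ => t
    | vs y => fun _ θ => θ _ y
    end t θ.

Fixpoint ren {G D : ctx} (r : forall σ, var G σ -> var D σ) {σ : ty}
    (t : tm G σ) : tm D σ :=
  match t with
  | Var x => Var (r _ x)
  | App s u => App (ren r s) (ren r u)
  | cK ρ σ => cK ρ σ
  | cS ρ σ τ => cS ρ σ τ
  | cPair σ τ => cPair σ τ
  | cFst σ τ => cFst σ τ
  | cSnd σ τ => cSnd σ τ
  | cZero => cZero
  | cSucc => cSucc
  | cRec σ => cRec σ
  end.

Definition wk {G : ctx} {τ σ : ty} (t : tm G σ) : tm (τ :: G) σ :=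
  ren (fun _ x => vs x) t.

Fixpoint subst {G D : ctx} (θ : forall σ, var G σ -> tm D σ) {σ : ty}
    (t : tm G σ) : tm D σ :=
  match t with
  | Var x => θ _ x
  | App s u => App (subst θ s) (subst θ u)
  | cK ρ σ => cK ρ σ
  | cS ρ σ τ => cS ρ σ τ
  | cPair σ τ => cPair σ τ
  | cFst σ τ => cFst σ τ
  | cSnd σ τ => cSnd σ τ
  | cZero => cZero
  | cSucc => cSucc
  | cRec σ => cRec σ
  end.

Definition up {G D : ctx} {τ : ty} (θ : forall σ, var G σ -> tm D σ) :
    forall σ, var (τ :: G) σ -> tm (τ :: D) σ :=
  scons (P := tm (τ :: D)) v0 (fun σ x => wk (θ σ x)).

Fixpoint fsubst {G D : ctx} (θ : forall σ, var G σ -> tm D σ) (A : fm G)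
    {struct A} : fm D :=
  match A in fm G' return (forall σ, var G' σ -> tm D σ) -> fm D with
  | Bot => fun _ => Bot
  | Eq s t => fun θ => subst θ s ≡ subst θ t
  | And A B => fun θ => fsubst θ A ∧ fsubst θ B
  | Or A B => fun θ => fsubst θ A ∨ fsubst θ B
  | Imp A B => fun θ => fsubst θ A ⊃ fsubst θ B
  | All σ A => fun θ => ∀[σ] fsubst (up θ) A
  | Ex σ A => fun θ => ∃[σ] fsubst (up θ) A
  end θ.

Definition fwk {G : ctx} {τ : ty} (A : fm G) : fm (τ :: G) :=
  fsubst (fun _ x => Var (vs x)) A.

Definition inst {G : ctx} {τ : ty} (A : fm (τ :: G)) (t : tm G τ) : fm G :=
  fsubst (scons (P := tm G) t (fun _ x => Var x)) A.

(** [A] with its variable [0] replaced by its successor, in the same context. *)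
Definition inst_succ {G : ctx} (A : fm (Nat :: G)) : fm (Nat :: G) :=
  fsubst (scons (P := tm (Nat :: G)) (cSucc · v0) (fun _ x => Var (vs x))) A.

Inductive axiom : forall G : ctx, fm G -> Prop :=
| ax_refl G σ (s : tm G σ) : axiom (s ≡ s)
| ax_sym G σ (s t : tm G σ) : axiom (s ≡ t ⊃ t ≡ s)
| ax_trans G σ (s t u : tm G σ) : axiom (s ≡ t ⊃ t ≡ u ⊃ s ≡ u)
| ax_app G σ τ (s s' : tm G (σ ⟶ τ)) (t t' : tm G σ) :
    axiom (s ≡ s' ⊃ t ≡ t' ⊃ s · t ≡ s' · t')
| ax_k G ρ σ (s : tm G ρ) (t : tm G σ) : axiom (cK ρ σ · s · t ≡ s)
| ax_s G ρ σ τ (s : tm G (ρ ⟶ σ ⟶ τ)) (t : tm G (ρ ⟶ σ)) (u : tm G ρ) :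
    axiom (cS ρ σ τ · s · t · u ≡ s · u · (t · u))
| ax_fst G σ τ (s : tm G σ) (t : tm G τ) : axiom (fst_ (pair_ s t) ≡ s)
| ax_snd G σ τ (s : tm G σ) (t : tm G τ) : axiom (snd_ (pair_ s t) ≡ t)
| ax_rec0 G σ (s : tm G σ) (t : tm G (Nat ⟶ σ ⟶ σ)) :
    axiom (cRec σ · s · t · cZero ≡ s)
| ax_recS G σ (s : tm G σ) (t : tm G (Nat ⟶ σ ⟶ σ)) (m : tm G Nat) :
    axiom (cRec σ · s · t · (cSucc · m) ≡ t · m · (cRec σ · s · t · m))
| ax_succ_inj G (s t : tm G Nat) : axiom (cSucc · s ≡ cSucc · t ⊃ s ≡ t)
| ax_succ_neq0 G (s : tm G Nat) : axiom (¬ (cSucc · s ≡ cZero))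
| ax_ind G (A : fm (Nat :: G)) :
    axiom (inst A cZero ⊃ (∀[Nat] (A ⊃ inst_succ A)) ⊃ ∀[Nat] A).

(** The variable condition of [all_i] and
    [ex_e] is expressed by weakening the hypotheses (and conclusion). *)
Inductive prv : forall G : ctx, list (fm G) -> fm G -> Prop :=
| prv_ax G (H : list (fm G)) A : axiom A -> prv H A
| prv_hyp G (H : list (fm G)) A : In A H -> prv H A
| bot_e G (H : list (fm G)) A : prv H Bot -> prv H A
| and_i G (H : list (fm G)) A B : prv H A -> prv H B -> prv H (A ∧ B)
| and_e1 G (H : list (fm G)) A B : prv H (A ∧ B) -> prv H A
| and_e2 G (H : list (fm G)) A B : prv H (A ∧ B) -> prv H B
| or_i1 G (H : list (fm G)) A B : prv H A -> prv H (A ∨ B)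
| or_i2 G (H : list (fm G)) A B : prv H B -> prv H (A ∨ B)
| or_e G (H : list (fm G)) A B C :
    prv H (A ∨ B) -> prv (A :: H) C -> prv (B :: H) C -> prv H C
| imp_i G (H : list (fm G)) A B : prv (A :: H) B -> prv H (A ⊃ B)
| imp_e G (H : list (fm G)) A B : prv H (A ⊃ B) -> prv H A -> prv H B
| all_i G (H : list (fm G)) σ (A : fm (σ :: G)) :
    prv (map fwk H) A -> prv H (∀[σ] A)
| all_e G (H : list (fm G)) σ (A : fm (σ :: G)) (t : tm G σ) :
    prv H (∀[σ] A) -> prv H (inst A t)
| ex_i G (H : list (fm G)) σ (A : fm (σ :: G)) (t : tm G σ) :
    prv H (inst A t) -> prv H (∃[σ] A)
| ex_e G (H : list (fm G)) σ (A : fm (σ :: G)) (C : fm G) :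
    prv H (∃[σ] A) -> prv (A :: map fwk H) (fwk C) -> prv H C.

Definition HAw_proves (A : fm []) : Prop := prv [] A.

Fixpoint pos (σ : ty) : ty :=
  match σ with
  | Nat => Nat
  | σ ⊗ τ => pos σ ⊗ pos τ
  | σ ⟶ τ => (pos σ ⟶ pos τ) ⊗ (pos σ ⟶ pos σ ⟶ neg τ ⟶ neg σ)
  end
with neg (σ : ty) : ty :=
  match σ with
  | Nat => Nat
  | σ ⊗ τ => (neg σ ⊗ neg τ) ⊗ Nat
  | σ ⟶ τ => pos σ ⊗ neg τ
  end.

Definition star {G : ctx} {σ τ : ty} (s : tm G (pos (σ ⟶ τ)))
    (t : tm G (pos σ)) : tm G (pos τ) :=
  fst_ (s : tm G ((pos σ ⟶ pos τ) ⊗ _)) · t.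

Notation "s ⋆ t" := (star s t) (at level 37, left associativity) : tm_scope.

(** Parameters are weakened when they move under quantifiers. *)
Fixpoint dom (σ : ty) (G : ctx) {struct σ} : tm G (pos σ) -> fm G :=
  match σ return tm G (pos σ) -> fm G with
  | Nat => fun _ => Top
  | σ ⊗ τ => fun x => dom (fst_ x) ∧ dom (snd_ x)
  | σ ⟶ τ => fun x =>
      (∀[pos σ] (@dom σ _ v0 ⊃ @dom τ _ (@star _ σ τ (wk x) v0)))
      ∧
      (∀[pos σ] ∀[pos σ] ∀[neg τ]
         (@dom σ _ v2 ⊃ @dom σ _ v1 ⊃
          @app τ _ (@star _ σ τ (wk (wk (wk x))) v2)
                   (@star _ σ τ (wk (wk (wk x))) v1) v0 ⊃
          @app σ _ v2 v1 (snd_ (wk (wk (wk x))) · v2 · v1 · v0)))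
  end
with app (σ : ty) (G : ctx) {struct σ} :
    tm G (pos σ) -> tm G (pos σ) -> tm G (neg σ) -> fm G :=
  match σ return tm G (pos σ) -> tm G (pos σ) -> tm G (neg σ) -> fm G with
  | Nat => fun x y _ => ¬ (x ≡ y)
  | σ ⊗ τ => fun x y z =>
      (snd_ z ≡ cZero ⊃ app (fst_ x) (fst_ y) (fst_ (fst_ z)))
      ∧
      (¬ (snd_ z ≡ cZero) ⊃ app (snd_ x) (snd_ y) (snd_ (fst_ z)))
  | σ ⟶ τ => fun x y z =>
      @dom σ _ (fst_ z)
      ∧
      @app τ _ (@star _ σ τ x (fst_ z)) (@star _ σ τ y (fst_ z)) (snd_ z)
  end.

Arguments dom σ {G} _.
Arguments app σ {G} _ _ _.

(* Main.v *)
(** If [f] is in the domain of [φ = (σ → 0) → (τ → 0)], its second component sends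
    a point of apartness [(v, k)] of [f * x] and [f * y] to a point of apartness
    [(z, m)] of [x] and [y], which means that [z] is in the domain of [σ] and
    [x * z ≢ y * z]. Hence [Z f x y v := fst (snd f x y (pair v 0))] works. The second
    components of [Z], as an element of [ρ^+], are irrelevant: the theorem does not
    ask for [dom_ρ Z]. *)

Require Import Defs.
From Stdlib Require Import List.
Import ListNotations.

Local Open Scope ty_scope.
Local Open Scope tm_scope.
Local Open Scope fm_scope.

Local Arguments wk : simpl never.

(** * Substitution calculus for terms, formulas, [dom] and [app] *)

Lemma var_case (G : ctx) (τ : ty) (P : forall σ, var (τ :: G) σ -> Prop) :
  P τ vz -> (forall σ (x : var G σ), P σ (vs x)) -> forall σ x, P σ x.
Proof.
  intros Hz Hs σ x.
  (* Matching on the context index, with [P] generalised over it, inverts the index [τ :: G] without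
     any equation between contexts. *)
  refine (match x as x' in var G' σ'
          return match G' return var G' σ' -> Prop with
                 | [] => fun _ => True
                 | τ' :: G' => fun x => forall P : forall σ, var (τ' :: G') σ -> Prop,
                     P τ' vz -> (forall σ (x : var G' σ), P σ (vs x)) -> P σ' x
                 end x'
          with vz => fun P Hz _ => Hz | vs y => fun P _ Hs => Hs _ y end P Hz Hs).
Qed.

Section Substitution.

Context {G D : ctx}.
Implicit Types θ : forall σ, var G σ -> tm D σ.

Lemma subst_ext θ θ' : (forall σ x, θ σ x = θ' σ x) ->
  forall σ (t : tm G σ), subst θ t = subst θ' t.
Proof. intros E σ t; induction t; cbn; congruence. Qed.

Lemma ren_subst_var (r : forall σ, var G σ -> var D σ) σ (t : tm G σ) :
  ren r t = subst (fun σ x => Var (r σ x)) t.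
Proof. induction t; cbn; congruence. Qed.

Lemma subst_subst {E : ctx} θ (η : forall σ, var D σ -> tm E σ) σ (t : tm G σ) :
  subst η (subst θ t) = subst (fun σ x => subst η (θ σ x)) t.
Proof. induction t; cbn; congruence. Qed.

Lemma up_ext {τ : ty} θ θ' : (forall σ x, θ σ x = θ' σ x) ->
  forall σ (x : var (τ :: G) σ), up θ x = up θ' x.
Proof. intros E; apply var_case; cbn; [reflexivity | intros; f_equal; apply E]. Qed.

End Substitution.

Lemma subst_id (G : ctx) (θ : forall σ, var G σ -> tm G σ) :
  (forall σ x, θ σ x = Var x) -> forall σ (t : tm G σ), subst θ t = t.
Proof. intros E σ t; induction t; cbn; congruence. Qed.

Lemma wk_subst_var (G : ctx) (τ σ : ty) (t : tm G σ) :
  wk (τ := τ) t = subst (fun σ x => Var (vs x)) t.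
Proof. apply ren_subst_var. Qed.

Lemma subst_wk (G D : ctx) (τ : ty) (θ : forall σ, var (τ :: G) σ -> tm D σ) σ (t : tm G σ) :
  subst θ (wk t) = subst (fun σ x => θ σ (vs x)) t.
Proof. rewrite wk_subst_var, subst_subst; reflexivity. Qed.

Lemma subst_up_wk (G D : ctx) (τ : ty) (θ : forall σ, var G σ -> tm D σ) σ (t : tm G σ) :
  subst (up (τ := τ) θ) (wk t) = wk (subst θ t).
Proof.
  rewrite subst_wk, wk_subst_var, subst_subst; apply subst_ext.
  intros; cbn; apply wk_subst_var.
Qed.

Lemma subst_scons_wk (G : ctx) (τ : ty) (u : tm G τ) σ (t : tm G σ) :
  subst (scons (P := tm G) u (fun _ x => Var x)) (wk t) = t.
Proof. rewrite subst_wk; apply subst_id; reflexivity. Qed.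

Lemma fsubst_ext (G : ctx) (A : fm G) : forall D (θ θ' : forall σ, var G σ -> tm D σ),
  (forall σ x, θ σ x = θ' σ x) -> fsubst θ A = fsubst θ' A.
Proof.
  induction A; intros D θ θ' E; cbn; f_equal;
    try (apply subst_ext; assumption); auto using up_ext.
Qed.

Lemma fsubst_id (G : ctx) (A : fm G) : forall (θ : forall σ, var G σ -> tm G σ),
  (forall σ x, θ σ x = Var x) -> fsubst θ A = A.
Proof.
  induction A; intros θ E; cbn; f_equal; try (apply subst_id; assumption); auto;
    apply IHA; apply var_case; cbn; intros; try rewrite E; reflexivity.
Qed.

Lemma fsubst_fsubst (G : ctx) (A : fm G) : forall D E
  (θ : forall σ, var G σ -> tm D σ) (η : forall σ, var D σ -> tm E σ),
  fsubst η (fsubst θ A) = fsubst (fun σ x => subst η (θ σ x)) A.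
Proof.
  induction A; intros D E θ η; cbn; f_equal; try apply subst_subst; auto;
    rewrite IHA; apply fsubst_ext; apply var_case; cbn; intros;
    try apply subst_up_wk; reflexivity.
Qed.

(** Lets an eigenvariable open a quantifier that has itself been weakened: the composite
    substitution is the identity. *)
Lemma inst_up_wk_v0 (G : ctx) (τ : ty) (A : fm (τ :: G)) :
  inst (fsubst (up (fun σ x => Var (vs x))) A) v0 = A.
Proof.
  unfold inst; rewrite fsubst_fsubst; apply fsubst_id.
  apply var_case; reflexivity.
Qed.

(** [dom] and [app] are mutually recursive, so both claims share one induction. Under binders the
    parameters are weakened, and [subst_up_wk] commutes that with the substitution. *)
Lemma fsubst_dom_app (σ : ty) :
  (forall G D (θ : forall σ, var G σ -> tm D σ) t,
     fsubst θ (dom σ t) = dom σ (subst θ t)) /\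
  (forall G D (θ : forall σ, var G σ -> tm D σ) s t u,
     fsubst θ (Defs.app σ s t u) = Defs.app σ (subst θ s) (subst θ t) (subst θ u)).
Proof.
  induction σ as [| σ [IHd IHa] τ [IHd' IHa'] | σ [IHd IHa] τ [IHd' IHa']];
    split; intros; cbn; rewrite ?IHd, ?IHa, ?IHd', ?IHa';
    cbn; rewrite ?subst_up_wk; reflexivity.
Qed.

Definition fsubst_dom σ := proj1 (fsubst_dom_app σ).
Definition fsubst_app σ := proj2 (fsubst_dom_app σ).

(** * Provable equality and replacement of equals *)

Section Equality.

Context {G : ctx} (H : list (fm G)).

Lemma prv_eq_refl σ (s : tm G σ) : prv H (s ≡ s).
Proof. apply prv_ax, ax_refl. Qed.

Lemma prv_eq_sym σ (s t : tm G σ) : prv H (s ≡ t) -> prv H (t ≡ s).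
Proof. apply imp_e, prv_ax, ax_sym. Qed.

Lemma prv_eq_trans σ (s t u : tm G σ) : prv H (s ≡ t) -> prv H (t ≡ u) -> prv H (s ≡ u).
Proof. intros E; apply imp_e; revert E; apply imp_e, prv_ax, ax_trans. Qed.

Lemma prv_eq_app σ τ (s s' : tm G (σ ⟶ τ)) (t t' : tm G σ) :
  prv H (s ≡ s') -> prv H (t ≡ t') -> prv H (s · t ≡ s' · t').
Proof. intros E; apply imp_e; revert E; apply imp_e, prv_ax, ax_app. Qed.

(** Terms contain no binders, so congruence of application suffices. *)
Lemma prv_eq_subst G' (θ θ' : forall σ, var G' σ -> tm G σ) :
  (forall σ x, prv H (θ σ x ≡ θ' σ x)) ->
  forall σ (t : tm G' σ), prv H (subst θ t ≡ subst θ' t).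
Proof.
  intros E σ t; induction t; cbn; auto using prv_eq_refl, prv_eq_app.
Qed.

End Equality.

Lemma prv_hd G (H : list (fm G)) A : prv (A :: H) A.
Proof. apply prv_hyp; left; reflexivity. Qed.

(* The equations are required to be hypotheses, not merely provable from [H]:
   this is stable under [map fwk], so weakening of derivations is not needed. *)
Definition eq_in {G D} (H : list (fm D)) (θ θ' : forall σ, var G σ -> tm D σ) : Prop :=
  forall σ x, θ σ x = θ' σ x \/ In (θ σ x ≡ θ' σ x) H \/ In (θ' σ x ≡ θ σ x) H.

Section EqIn.

Context {G D : ctx}.
Implicit Types (H : list (fm D)) (θ : forall σ, var G σ -> tm D σ).

Lemma eq_in_sym H θ θ' : eq_in H θ θ' -> eq_in H θ' θ.
Proof. intros E σ x; destruct (E σ x) as [e | [e | e]]; auto. Qed.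

Lemma eq_in_cons H A θ θ' : eq_in H θ θ' -> eq_in (A :: H) θ θ'.
Proof. intros E σ x; destruct (E σ x) as [e | [e | e]]; cbn; auto. Qed.

(** [fwk] turns an equation of [H] into the equation between the weakened terms, which are the
    values of the lifted substitutions. *)
Lemma eq_in_up H (τ : ty) θ θ' :
  eq_in H θ θ' -> eq_in (map fwk H) (up (τ := τ) θ) (up θ').
Proof.
  intros E; red; apply var_case; [left; reflexivity |]; intros σ x; cbn.
  rewrite !wk_subst_var.
  destruct (E σ x) as [e | [e | e]];
    [rewrite e; auto | right; left | right; right];
    apply (in_map (@fwk D τ)) in e; exact e.
Qed.

Lemma eq_in_prv H θ θ' : eq_in H θ θ' -> forall σ x, prv H (θ σ x ≡ θ' σ x).
Proof.
  intros E σ x; destruct (E σ x) as [e | [e | e]].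
  - rewrite e; apply prv_eq_refl.
  - apply prv_hyp, e.
  - apply prv_eq_sym, prv_hyp, e.
Qed.

End EqIn.

(** Comparing two whole substitutions, rather than replacing one variable, gives an induction
    hypothesis that passes under quantifiers. Premises of implications are contravariant, hence
    [eq_in_sym]. *)
Lemma leibniz (G : ctx) (A : fm G) : forall D (H : list (fm D)) (θ θ' : forall σ, var G σ -> tm D σ),
  eq_in H θ θ' -> prv H (fsubst θ A ⊃ fsubst θ' A).
Proof.
  induction A; intros D H θ θ' E; cbn; apply imp_i.
  - apply prv_hd.
  - apply prv_eq_trans with (subst θ t).
    + apply prv_eq_subst, eq_in_prv, eq_in_sym, eq_in_cons, E.
    + eapply prv_eq_trans; [apply prv_hd |].
      apply prv_eq_subst, eq_in_prv, eq_in_cons, E.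
  - apply and_i.
    + eapply imp_e; [eapply IHA1, eq_in_cons, E |].
      eapply and_e1, prv_hd.
    + eapply imp_e; [eapply IHA2, eq_in_cons, E |].
      eapply and_e2, prv_hd.
  - eapply or_e; [apply prv_hd | apply or_i1 | apply or_i2].
    + eapply imp_e; [eapply IHA1, eq_in_cons, eq_in_cons, E | apply prv_hd].
    + eapply imp_e; [eapply IHA2, eq_in_cons, eq_in_cons, E | apply prv_hd].
  - apply imp_i.
    eapply imp_e; [eapply IHA2, eq_in_cons, eq_in_cons, E |].
    eapply imp_e; [apply prv_hyp; right; left; reflexivity |].
    eapply imp_e; [eapply IHA1, eq_in_sym, eq_in_cons, eq_in_cons, E | apply prv_hd].
  - apply all_i; cbn.
    eapply imp_e; [eapply IHA, eq_in_cons, eq_in_up, E |].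
    (* Only the conclusion is rewritten, into the instance at [v0] of the weakened universal
       hypothesis. *)
    rewrite <- (inst_up_wk_v0 _ _ (fsubst (up θ) A)) at 2.
    apply all_e, prv_hd.
  - eapply ex_e; [apply prv_hd |]; cbn.
    apply ex_i with (t := v0); rewrite inst_up_wk_v0.
    eapply imp_e; [eapply IHA, eq_in_cons, eq_in_cons, eq_in_up, E | apply prv_hd].
Qed.

Lemma leibniz_inst (G : ctx) (H : list (fm G)) (τ : ty) (A : fm (τ :: G)) (s t : tm G τ) :
  prv H (s ≡ t) -> prv H (inst A s) -> prv H (inst A t).
Proof.
  (* The equation is discharged into the hypothesis list, where [eq_in] looks for it. *)
  intros E; apply imp_e; revert E; apply imp_e, imp_i, leibniz.
  red; apply var_case; cbn; auto.
Qed.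

Lemma dom_eq (σ : ty) (G : ctx) (H : list (fm G)) (s t : tm G (pos σ)) :
  prv H (s ≡ t) -> prv H (dom σ s) -> prv H (dom σ t).
Proof.
  intros E Hs.
  pose proof (leibniz_inst _ _ _ (dom σ v0) _ _ E) as L.
  unfold inst in L; rewrite !fsubst_dom in L; auto.
Qed.

Lemma neq_eq (σ : ty) (G : ctx) (H : list (fm G)) (s s' t t' : tm G σ) :
  prv H (s ≡ s') -> prv H (t ≡ t') -> prv H (¬ s ≡ t) -> prv H (¬ s' ≡ t').
Proof.
  intros Es Et Hn.
  pose proof (leibniz_inst _ _ _ (¬ v0 ≡ wk t) _ _ Es) as L.
  pose proof (leibniz_inst _ _ _ (¬ wk s' ≡ v0) _ _ Et) as L'.
  unfold inst in L, L'; cbn in L, L'; rewrite !subst_scons_wk in L, L'; auto.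
Qed.

(** The second conjunct of [dom (σ ⟶ τ) f], instantiated at [u], [v], [w]. *)
Lemma dom_arr_app (σ τ : ty) (G : ctx) (H : list (fm G)) (f : tm G (pos (σ ⟶ τ)))
    (u v : tm G (pos σ)) (w : tm G (neg τ)) :
  prv H (dom (σ ⟶ τ) f) -> prv H (dom σ u) -> prv H (dom σ v) ->
  prv H (Defs.app τ (f ⋆ u) (f ⋆ v) w) ->
  prv H (Defs.app σ u v (@snd_ _ (pos σ ⟶ pos τ) _ f · u · v · w)).
Proof.
  intros Hf Hu Hv Hw; cbn in Hf; apply and_e2 in Hf.
  apply (all_e u) in Hf; cbn in Hf.
  apply (all_e v) in Hf; cbn in Hf.
  apply (all_e w) in Hf; unfold inst in Hf; cbn in Hf.
  rewrite !fsubst_dom, !fsubst_app in Hf; cbn in Hf.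
  rewrite ?subst_up_wk, ?subst_scons_wk in Hf.
  eapply imp_e, Hw; eapply imp_e, Hv; eapply imp_e, Hu; exact Hf.
Qed.

(** * Abstraction for ordinary application and for [⋆] *)

(* Bracket abstraction, with [S K K] as identity. *)
Fixpoint lam {G : ctx} {τ σ : ty} (t : tm (τ :: G) σ) : tm G (τ ⟶ σ) :=
  match t with
  | Var x => scons (P := fun σ => tm G (τ ⟶ σ))
               (cS τ (τ ⟶ τ) τ · cK τ (τ ⟶ τ) · cK τ τ)
               (fun σ x => cK σ τ · Var x) x
  | App s u => cS _ _ _ · lam s · lam u
  | cK ρ σ => cK _ _ · cK ρ σ
  | cS ρ σ τ => cK _ _ · cS ρ σ τ
  | cPair σ τ => cK _ _ · cPair σ τ
  | cFst σ τ => cK _ _ · cFst σ τ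
  | cSnd σ τ => cK _ _ · cSnd σ τ
  | cZero => cK _ _ · cZero
  | cSucc => cK _ _ · cSucc
  | cRec σ => cK _ _ · cRec σ
  end.

(* [lam] does not commute with substitution, so [θ] is part of the statement;
   this is what makes iterated abstractions usable without the ξ-rule. *)
Lemma lam_beta (G D : ctx) (H : list (fm D)) (θ : forall σ, var G σ -> tm D σ)
    τ σ (t : tm (τ :: G) σ) (u : tm D τ) :
  prv H (subst θ (lam t) · u ≡ subst (scons (P := tm D) u θ) t).
Proof.
  induction t as [σ x | | | | | | | | |]; cbn; try (apply prv_ax, ax_k).
  - revert σ x; apply var_case; cbn.
    + eapply prv_eq_trans; [apply prv_ax, ax_s | apply prv_ax, ax_k].
    + intros; apply prv_ax, ax_k.
  - eapply prv_eq_trans; [apply prv_ax, ax_s | apply prv_eq_app; assumption].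
Qed.

Fixpoint inhabitant {G : ctx} (σ : ty) : tm G σ :=
  match σ with
  | Nat => cZero
  | σ ⊗ τ => pair_ (inhabitant σ) (inhabitant τ)
  | σ ⟶ τ => cK τ σ · inhabitant τ
  end.

(** Abstraction with respect to [⋆]: the function goes into the first component, and a default term
    fills the second. *)
Definition star_lam {G : ctx} {σ τ : ty} (t : tm (pos σ :: G) (pos τ)) :
    tm G (pos (σ ⟶ τ)) :=
  pair_ (lam t) (inhabitant (pos σ ⟶ pos σ ⟶ neg τ ⟶ neg σ)).

Lemma prv_eq_star (σ τ : ty) (G : ctx) (H : list (fm G))
    (s s' : tm G (pos (σ ⟶ τ))) (u : tm G (pos σ)) :
  prv H (s ≡ s') -> prv H (s ⋆ u ≡ s' ⋆ u).
Proof.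
  intros E; apply prv_eq_app; [apply prv_eq_app |]; auto using prv_eq_refl.
Qed.

(** The right side is again a substituted body, so nested abstractions unfold one argument at a
    time, each extending [θ]. *)
Lemma star_beta (G D : ctx) (H : list (fm D)) (θ : forall σ, var G σ -> tm D σ)
    (σ τ : ty) (t : tm (pos σ :: G) (pos τ)) (u : tm D (pos σ)) :
  prv H (subst θ (star_lam t) ⋆ u ≡ subst (scons (P := tm D) u θ) t).
Proof.
  eapply prv_eq_trans; [| apply lam_beta].
  apply prv_eq_app; [apply prv_ax; cbn; apply ax_fst | apply prv_eq_refl].
Qed.

(** * The modulus term and its correctness *)

Section Modulus.

Context (σ τ : ty).
Let φ := (σ ⟶ Nat) ⟶ (τ ⟶ Nat).
Let ρ := φ ⟶ (σ ⟶ Nat) ⟶ (σ ⟶ Nat) ⟶ τ ⟶ σ.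

(** Any term of type [Nat] could replace [cZero]: [app Nat] depends only on its first two
    arguments. *)
Definition modulus_body {G : ctx} (f : tm G (pos φ)) (x y : tm G (pos (σ ⟶ Nat)))
    (v : tm G (pos τ)) : tm G (pos σ) :=
  fst_ (σ := pos σ) (τ := Nat)
    (@snd_ _ (pos (σ ⟶ Nat) ⟶ pos (τ ⟶ Nat)) _ f · x · y · (pair_ v cZero)).

Definition modulus : tm [] (pos ρ) :=
  star_lam (σ := φ) (τ := (σ ⟶ Nat) ⟶ (σ ⟶ Nat) ⟶ τ ⟶ σ)
    (star_lam (σ := σ ⟶ Nat) (τ := (σ ⟶ Nat) ⟶ τ ⟶ σ)
      (star_lam (σ := σ ⟶ Nat) (τ := τ ⟶ σ)
        (star_lam (σ := τ) (τ := σ) (modulus_body v3 v2 v1 v0)))).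

Context {G : ctx} (H : list (fm G)) (θ : forall σ, var [] σ -> tm G σ).
Context (f : tm G (pos φ)) (x y : tm G (pos (σ ⟶ Nat))) (v : tm G (pos τ)).

Lemma modulus_eq : prv H (subst θ modulus ⋆ f ⋆ x ⋆ y ⋆ v ≡ modulus_body f x y v).
Proof.
  (* Peeling off [y], [x] and [v] by congruence exposes the innermost application, to [f]; the next
     steps proceed outwards. *)
  eapply prv_eq_trans; [do 3 apply prv_eq_star; apply star_beta |].
  eapply prv_eq_trans; [do 2 apply prv_eq_star; apply star_beta |].
  eapply prv_eq_trans; [apply prv_eq_star; apply star_beta |].
  exact (star_beta _ _ _ (scons y (scons x (scons f θ))) _ _ (modulus_body v3 v2 v1 v0) v).
Qed.

Lemma modulus_correct :
  prv H (dom φ f) -> prv H (dom (σ ⟶ Nat) x) -> prv H (dom (σ ⟶ Nat) y) ->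
  prv H (dom τ v) -> prv H (¬ f ⋆ x ⋆ v ≡ f ⋆ y ⋆ v) ->
  prv H (dom σ (subst θ modulus ⋆ f ⋆ x ⋆ y ⋆ v) ∧
         ¬ x ⋆ (subst θ modulus ⋆ f ⋆ x ⋆ y ⋆ v) ≡ y ⋆ (subst θ modulus ⋆ f ⋆ x ⋆ y ⋆ v)).
Proof.
  intros Hf Hx Hy Hv Hn.
  (* [app] speaks of the first projection of the pair, which equals [v] only provably, so the facts
     about [v] must be transported. *)
  assert (Ev : prv H (v ≡ fst_ (pair_ v cZero))) by apply prv_eq_sym, prv_ax, ax_fst.
  assert (Happ : prv H (Defs.app (τ ⟶ Nat) (f ⋆ x) (f ⋆ y) (pair_ v cZero))).
  { apply and_i.
    - apply (dom_eq _ _ _ _ _ Ev Hv).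
    - cbn; refine (neq_eq _ _ _ _ _ _ _ _ _ Hn); apply prv_eq_app;
        auto using prv_eq_refl. }
  pose proof (dom_arr_app _ _ _ _ _ _ _ _ Hf Hx Hy Happ) as Hz.
  apply and_i.
  - eapply dom_eq; [apply prv_eq_sym, modulus_eq |].
    eapply and_e1, Hz.
  (* [Hz] separates [x] and [y] at [modulus_body f x y v]; [modulus_eq] moves this to the value of
     the modulus. *)
  - apply and_e2 in Hz; cbn in Hz.
    refine (neq_eq _ _ _ _ _ _ _ _ _ Hz); apply prv_eq_app;
      auto using prv_eq_refl, prv_eq_sym, modulus_eq.
Qed.

End Modulus.

(* In the matrix: Z = v4, f = v3, x = v2, y = v1, v = v0. *)
Theorem theorem5p6 (σ τ : ty) :
  let φ := (σ ⟶ Nat) ⟶ (τ ⟶ Nat) in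
  let ρ := φ ⟶ (σ ⟶ Nat) ⟶ (σ ⟶ Nat) ⟶ τ ⟶ σ in
  HAw_proves
    (∃[pos ρ] ∀[pos φ]
      (dom φ v0 ⊃
       ∀[pos (σ ⟶ Nat)]
        (dom (σ ⟶ Nat) v0 ⊃
         ∀[pos (σ ⟶ Nat)]
          (dom (σ ⟶ Nat) v0 ⊃
           ∀[pos τ]
            (dom τ v0 ⊃
             ¬ (v3 ⋆ v2 ⋆ v0 ≡ v3 ⋆ v1 ⋆ v0) ⊃
             dom σ (v4 ⋆ v3 ⋆ v2 ⋆ v1 ⋆ v0)
             ∧ ¬ (v2 ⋆ (v4 ⋆ v3 ⋆ v2 ⋆ v1 ⋆ v0) ≡ v1 ⋆ (v4 ⋆ v3 ⋆ v2 ⋆ v1 ⋆ v0))))))).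
Proof.
  intros φ ρ.
  apply ex_i with (t := modulus σ τ).
  unfold inst; cbn -[dom modulus].
  do 4 (apply all_i, imp_i; cbn -[dom modulus]).
  apply imp_i; cbn -[dom modulus].
  unfold fwk; rewrite !fsubst_dom; cbn -[dom modulus].
  (* The weakenings of the closed witness merge into a single substitution, the [θ] of
     [modulus_correct]. *)
  rewrite !wk_subst_var, !subst_subst.
  (* Hypotheses are stacked latest first, so the one on [f] lies deepest. *)
  apply modulus_correct; apply prv_hyp; cbn -[dom modulus].
  - do 4 right; left; reflexivity.
  - do 3 right; left; reflexivity.
  - do 2 right; left; reflexivity.
  - do 1 right; left; reflexivity.
  - left; reflexivity.
Qed.
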